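(* Let $i \ge 0$ be an integer and let $\preceq$ be a monomial order on $K[X]$ satisfying $\pi(u) \preceq \pi(v)$ whenever $\pi \in \mathrm{Inc}(\mathbb{N})^i$ and $u, v \in K[X]$ are monomials with $u \preceq v$. Then every $\mathrm{Inc}(\mathbb{N})^i$-invariant ideal of $K[X]$ admits a finite $\mathrm{Inc}(\mathbb{N})^i$-Gröbner basis with respect to $\preceq$.
   Context: $K$ is an arbitrary field, $c \ge 1$ is a fixed integer, and $K[X]$ is the polynomial ring over $K$ in the variables $X=\{x_{j,k} \mid 1 \le j \le c,\ k \in \mathbb{N}\}$, where $\mathbb{N}=\{1,2,\ldots\}$. $\mathrm{Inc}(\mathbb{N})$ is the monoid (under composition) of strictly increasing functions $\pi:\mathbb{N}\to\mathbb{N}$, and for an integer $i\ge 0$, $\mathrm{Inc}(\mathbb{N})^i=\{\pi\in\mathrm{Inc}(\mathbb{N}) \mid \pi(j)=j \text{ for all } j\le i\}$, so $\mathrm{Inc}(\mathbb{N})^0=\mathrm{Inc}(\mathbb{N})$. It acts on $K[X]$ by $K$-algebra homomorphisms via $\pi\cdot x_{j,k}=x_{j,\pi(k)}$. An ideal $I\subseteq K[X]$ is $\mathrm{Inc}(\mathbb{N})^i$-invariant if $\pi(f)\in I$ for all $f\in I$, $\pi\in\mathrm{Inc}(\mathbb{N})^i$. A monomial order is a total order on the monomials of $K[X]$ that is compatible with multiplication and a well-order; $\mathrm{in}_\preceq(f)$ denotes the initial (largest) monomial of a nonzero polynomial $f$. An $\mathrm{Inc}(\mathbb{N})^i$-Gröbner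 basis of an $\mathrm{Inc}(\mathbb{N})^i$-invariant ideal $I$ with respect to $\preceq$ is a subset $B\subseteq I$ such that for each nonzero $f\in I$ there are a nonzero $g\in B$ and a $\pi\in\mathrm{Inc}(\mathbb{N})^i$ such that $\mathrm{in}_\preceq(\pi(g))$ divides $\mathrm{in}_\preceq(f)$. *)

(* Defs.v *)
From HB Require Import structures.
From mathcomp Require Import all_boot all_order all_algebra.
From mathcomp Require Import finmap.
From mathcomp Require Import monalg.

Set Implicit Arguments.
Unset Strict Implicit.
Unset Printing Implicit Defensive.

Import GRing.Theory.
Local Open Scope ring_scope.

(* Rows and columns are numbered from 0: the pair (j, k) stands for the
   variable x_{j+1,k+1}.  A self-map of {1, 2, ...} is likewise represented by
   its conjugate under k |-> k - 1, so that fixing 1, ..., i becomes fixing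
   every k < i. *)
Notation xvar c := ('I_c * nat)%type.
Notation xmon c := {cmonom (xvar c)}.
Notation xpoly K c := {malg K[xmon c]}.

Definition inc_map (i : nat) (p : nat -> nat) : Prop :=
  {homo p : j k / (j < k)%N} /\ (forall j, (j < i)%N -> p j = j).

Definition inc_var c (p : nat -> nat) (x : xvar c) : xvar c := (x.1, p x.2).

Definition inc_mon c (p : nat -> nat) (u : xmon c) : xmon c :=
  \big[mmul/mone]_(x <- finsupp u) expcmn (ucm (inc_var p x)) (u x).

Definition inc_act (K : fieldType) c (p : nat -> nat) (f : xpoly K c) :
  xpoly K c :=
  \sum_(u <- msupp f) << f@_u *g inc_mon p u >>.

(* Ideals are Prop-valued, so that membership need not be decidable. *)
Definition is_ideal (R : comNzRingType) (I : R -> Prop) : Prop :=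
  [/\ I 0,
      forall f g, I f -> I g -> I (f + g)
    & forall h f, I f -> I (h * f)].

Definition inc_invariant (K : fieldType) c (i : nat)
    (I : xpoly K c -> Prop) : Prop :=
  forall f p, I f -> inc_map i p -> I (inc_act p f).

Definition mon_dvd c (u v : xmon c) : Prop := exists w, v = mmul u w.

Definition monomial_order c (le : xmon c -> xmon c -> Prop) : Prop :=
  [/\ (forall u, le u u),
      (forall u v, le u v -> le v u -> u = v),
      (forall u v w, le u v -> le v w -> le u w)
    & (forall u v, le u v \/ le v u)] /\
  [/\ (forall u v w, le u v -> le (mmul u w) (mmul v w))
    & (forall S : xmon c -> Prop, (exists u, S u) ->
         exists2 u, S u & forall v, S v -> le u v)].

Definition inc_compatible c (i : nat) (le : xmon c -> xmon c -> Prop) : Prop :=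
  forall p u v, inc_map i p -> le u v -> le (inc_mon p u) (inc_mon p v).

(* [initial_mon le f u] reads in(f) = u; it holds of exactly one u when f is
   nonzero and of none when f = 0. *)
Definition initial_mon (K : fieldType) c (le : xmon c -> xmon c -> Prop)
    (f : xpoly K c) (u : xmon c) : Prop :=
  u \in msupp f /\ (forall v, v \in msupp f -> le v u).

Definition inc_groebner_basis (K : fieldType) c (i : nat)
    (le : xmon c -> xmon c -> Prop) (I B : xpoly K c -> Prop) : Prop :=
  (forall g, B g -> I g) /\
  (forall f, I f -> f <> 0 ->
     exists g p u v,
       [/\ B g, g <> 0 & inc_map i p] /\
       [/\ initial_mon le (inc_act p g) u, initial_mon le f v & mon_dvd u v]).

(* The facts below confirm that [inc_act p] is the K-algebra homomorphism
   determined by x_{j,k} |-> x_{j,p(k)}, and that it extends [inc_mon p]. *)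
Lemma expcmnE c (m : xmon c) n x : expcmn m n x = (m x * n)%N.
Proof.
case: n => [|n]; first by rewrite /expcmn /= cm1 muln0.
rewrite /expcmn /iterop iteriS /=; elim: n => [|n IHn] /=.
  by rewrite muln1.
by rewrite mulcmE IHn [RHS]mulnS.
Qed.

Lemma cm_bigE c (T : Type) (s : seq T) (F : T -> xmon c) x :
  (\big[mmul/mone]_(t <- s) F t) x = (\sum_(t <- s) F t x)%N.
Proof.
elim: s => [|t s IHs]; first by rewrite !big_nil cm1.
by rewrite !big_cons cmM IHs.
Qed.

Lemma inc_monE c p (u : xmon c) (D : {fset xvar c}) y :
  (finsupp u `<=` D)%fset ->
  inc_mon p u y = (\sum_(x <- D) (inc_var p x == y) * u x)%N.
Proof.
move=> sD; rewrite cm_bigE (big_fset_incl _ sD) /=.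
  by apply: eq_bigr => x _; rewrite expcmnE cmU.
by move=> x _ /fsfun_dflt ->; rewrite expcmnE muln0.
Qed.

Lemma inc_mon1 c p : inc_mon p mone = mone :> xmon c.
Proof. by rewrite /inc_mon mdom1 big_seq_fset0. Qed.

Lemma inc_monU c p (x : xvar c) : inc_mon p (ucm x) = ucm (inc_var p x).
Proof.
apply/eqP/cmP => y; rewrite (@inc_monE _ _ _ [fset x]%fset) ?mdomU //.
by rewrite big_seq_fset1 !cmU eqxx muln1.
Qed.

Lemma inc_monM c p (u v : xmon c) :
  inc_mon p (mmul u v) = mmul (inc_mon p u) (inc_mon p v).
Proof.
apply/eqP/cmP => y.
rewrite cmM !(@inc_monE _ _ _ (finsupp u `|` finsupp v)%fset) ?mdomD //;
  rewrite ?fsubsetUl ?fsubsetUr //.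
by rewrite -big_split; apply: eq_bigr => x _; rewrite /= cmM mulnDr.
Qed.

Section IncAct.
Context (K : fieldType) (c : nat) (p : nat -> nat).

Let h (u : xmon c) : xpoly K c := << inc_mon p u >>.

Let h_morph : mmorphism h.
Proof.
split=> [u v|] /=; last by rewrite /h inc_mon1.
by rewrite /h inc_monM malgM_def fgmulUU mulr1.
Qed.

HB.instance Definition _ := isMultiplicative.Build (xmon c) (xpoly K c) h h_morph.

Lemma inc_actE (f : xpoly K c) : inc_act p f = mmap (@malgC (xmon c) K) h f.
Proof.
rewrite mmapE; apply: eq_bigr => u _.
by rewrite /h malgM_def fgmulUU mul1m mulr1.
Qed.

Lemma inc_actD (f g : xpoly K c) : inc_act p (f + g) = inc_act p f + inc_act p g.
Proof. by rewrite !inc_actE mmapD. Qed.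

Lemma inc_actM (f g : xpoly K c) : inc_act p (f * g) = inc_act p f * inc_act p g.
Proof. by rewrite !inc_actE rmorphM. Qed.

Lemma inc_actC (a : K) : inc_act p a%:MP = a%:MP :> xpoly K c.
Proof. by rewrite inc_actE mmapC. Qed.

Lemma inc_actU (u : xmon c) : inc_act p << u >> = << inc_mon p u >> :> xpoly K c.
Proof. by rewrite inc_actE mmapU mul1r. Qed.

Lemma inc_actX (j : 'I_c) (k : nat) :
  inc_act p << ucm (j, k) >> = << ucm (j, p k) >> :> xpoly K c.
Proof. by rewrite inc_actU inc_monU. Qed.

End IncAct.

(* Main.v *)
Require Import Defs.
From mathcomp Require Import all_boot all_order all_algebra.
From mathcomp Require Import finmap monalg.
From mathcomp Require boolp.

(** Since [le] is compatible with shifts, shifting commutes with taking initial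
    monomials: an increasing map [p] is injective, so [inc_act p] merely
    relabels the terms of [f] and keeps their order ([initial_mon_inc_act]).
    A family of nonzero elements of the ideal is therefore a Groebner basis
    when the initial monomial of every nonzero element lies above that of a
    member in the quasi-order [inc_dvd i], where [u] is below [v] when some
    shift of [u] fixing the first [i] columns divides [v].  A finite such
    family exists because [inc_dvd i] is a well-quasi-order ([wqo_inc_dvd]):
    any subset of a well-quasi-order has finitely many members such that each
    of its elements lies above one of them ([wqo_finite_basis]).

    To see that [inc_dvd i] is a well-quasi-order, cut the exponent matrix of a
    monomial after its first [i] columns.  These form a vector of fixed length,
    and comparing such vectors entry by entry is a well-quasi-order by
    Dickson's lemma ([wqo_pointwise]).  The remaining columns form a word over
    the alphabet of columns.  Compare words by subword embeddings that send
    each letter to an entrywise larger or equal one; this is a well-quasi-order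
    by Higman's lemma ([higman]), proved by the minimal bad sequence argument
    of Nash-Williams.  Such an embedding extends to a strictly increasing map
    of column indices, hence to a shift that makes [u] divide [v]
    ([inc_dvdP]). *)

Set Implicit Arguments.
Unset Strict Implicit.
Unset Printing Implicit Defensive.

Import GRing.Theory.
Local Open Scope ring_scope.

(** * Well-quasi-orders *)

(** For a reflexive transitive [R] this is the usual notion of
    well-quasi-order.  In this form it passes to preimages and to larger
    relations at once. *)
Definition wqo {T : Type} (R : T -> T -> Prop) : Prop :=
  forall f : nat -> T, exists a b, (a < b)%N /\ R (f a) (f b).

Lemma wqo_preim {S T : Type} (h : S -> T) (R : T -> T -> Prop) :
  wqo R -> wqo (fun x y => R (h x) (h y)).
Proof. by move=> wR f; apply: (wR (h \o f)). Qed.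

Lemma wqo_sub {T : Type} (R R' : T -> T -> Prop) :
  (forall x y, R x y -> R' x y) -> wqo R -> wqo R'.
Proof.
move=> sR wR f; have [a [b [ab /sR Rab]]] := wR f.
by exists a, b.
Qed.

Lemma wqo_leq : wqo (fun m n : nat => (m <= n)%N).
Proof.
move=> f; apply: boolp.contrapT => bad.
have desc a b : (a < b)%N -> (f b < f a)%N.
  by move=> ab; rewrite ltnNge; apply/negP => le_ab; apply: bad; exists a, b.
have fbound n : (f n + n <= f 0)%N.
  elim: n => [|n IHn]; first by rewrite addn0.
  by apply: leq_trans IHn; rewrite addnS -addSn leq_add2r desc.
by have := fbound (f 0).+1; rewrite addnS ltnNge leq_addl.
Qed.

Lemma homo_ltnS (g : nat -> nat) :
  (forall n, (g n < g n.+1)%N) -> {homo g : a b / (a < b)%N}.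
Proof. by move=> gS; apply: homo_ltn gS; apply: ltn_trans. Qed.

(** Call an index terminal when no later index is above it.  Infinitely many
    terminal indices would form a sequence contradicting [wqo R], so from some
    [N] on every index has a successor, and iterating successors gives a chain,
    which transitivity makes monotone. *)
Lemma wqo_monotone {T : Type} (R : T -> T -> Prop) :
  (forall x y z, R x y -> R y z -> R x z) -> wqo R ->
  forall f : nat -> T, exists2 g : nat -> nat,
    {homo g : a b / (a < b)%N} &
    forall a b, (a < b)%N -> R (f (g a)) (f (g b)).
Proof.
move=> Rtr wR f.
pose ext n := exists m, (n < m)%N /\ R (f n) (f m).
have [N extN] : exists N, forall n, (N <= n)%N -> ext n.
  apply: boolp.contrapT => noN.
  have /boolp.choice[t tP] : forall N, exists n, (N <= n)%N /\ ~ ext n.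
    move=> N; apply: boolp.contrapT => no; apply: noN; exists N => n Nn.
    by apply: boolp.contrapT => next; apply: no; exists n.
  pose g := fix g n := if n is m.+1 then t (g m).+1 else t 0%N.
  have gS n : (g n < g n.+1)%N by case: (tP (g n).+1).
  have gP n : ~ ext (g n) by case: n => [|n]; [case: (tP 0%N)|case: (tP (g n).+1)].
  have [a [b [ab Rab]]] := wR (f \o g).
  by apply: (gP a); exists (g b); split=> //; apply: (homo_ltnS gS).
have /boolp.choice[t tP] : forall n, exists m,
    (N <= n)%N -> (n < m)%N /\ R (f n) (f m).
  move=> n; case: (leqP N n) => [/extN[m mP]|_]; first by exists m.
  by exists 0%N.
pose g n := iter n t N.
have gN n : (N <= g n)%N.
  by elim: n => //= n IHn; apply: leq_trans (IHn) (ltnW _); case: (tP _ IHn).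
exists g.
  by apply: homo_ltnS => n; case: (tP _ (gN n)).
move=> a b; elim: b => // b IHb; rewrite ltnS leq_eqVlt => /orP[/eqP ->|ab].
  by case: (tP _ (gN b)).
by apply: Rtr (IHb ab) _; case: (tP _ (gN b)).
Qed.

(** The product of two well-quasi-orders, with both factors placed on one type
    so that products of all shapes arise through [wqo_preim]: a pair for [R']
    found along an [R]-monotone subsequence is also a pair for [R]. *)
Lemma wqo_and {T : Type} (R R' : T -> T -> Prop) :
  (forall x y z, R x y -> R y z -> R x z) -> wqo R -> wqo R' ->
  wqo (fun x y => R x y /\ R' x y).
Proof.
move=> Rtr wR wR' f; have [g gh gR] := wqo_monotone Rtr wR f.
have [a [b [ab R'ab]]] := wR' (f \o g).
by exists (g a), (g b); split; [apply: gh|split; [apply: gR|]].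
Qed.

(** Dickson's lemma, with the coordinates listed by [s]. *)
Lemma wqo_pointwise {X : eqType} (s : seq X) :
  wqo (fun u v : X -> nat => forall x, x \in s -> (u x <= v x)%N).
Proof.
elim: s => [|x s IHs]; first by move=> f; exists 0%N, 1%N.
have wx : wqo (fun u v : X -> nat => (u x <= v x)%N).
  exact: (@wqo_preim _ _ (fun u => u x) _ wqo_leq).
have tr (u v w : X -> nat) : (u x <= v x -> v x <= w x -> u x <= w x)%N.
  exact: leq_trans.
apply: wqo_sub (wqo_and tr wx IHs) => u v [uvx uvs] y.
by rewrite inE => /orP[/eqP ->|/uvs].
Qed.

(** Otherwise one could keep adding a member of [S] that is above none of those
    already listed, and the members added would contradict [wqo R]. *)
Lemma wqo_finite_basis {T : eqType} (R : T -> T -> Prop) (S : T -> Prop) :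
  wqo R ->
  exists2 s : seq T, (forall y, y \in s -> S y) &
    forall x, S x -> exists2 y, y \in s & R y x.
Proof.
move=> wR; apply: boolp.contrapT => nobasis.
have /boolp.choice[t tP] : forall s : seq T, exists x,
    (forall y, y \in s -> S y) ->
    S x /\ forall y, y \in s -> ~ R y x.
  move=> s; apply: boolp.contrapT => no.
  have sS : forall y, y \in s -> S y.
    apply: boolp.contrapT => nsS; apply: no.
    have [[x]|nT] := boolp.pselect (exists x : T, True).
      by exists x.
    by case: nsS => y; case: nT; exists y.
  apply: nobasis; exists s => // x Sx; apply: boolp.contrapT => nx.
  by apply: no; exists x => _; split=> // y ys Ryx; apply: nx; exists y.
pose L := fix L n := if n is m.+1 then t (L m) :: L m else [::].
have LS n : forall y, y \in (L n) -> S y.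
  by elim: n => //= n IHn y; rewrite inE => /orP[/eqP ->|/IHn //]; case: (tP _ IHn).
have Lin a b : (a < b)%N -> t (L a) \in L b.
  elim: b => // b IHb; rewrite ltnS leq_eqVlt inE => /orP[/eqP ->|/IHb ->].
    by rewrite eqxx.
  by rewrite orbT.
have [a [b [ab Rab]]] := wR (t \o L).
by have [_ /(_ _ (Lin _ _ ab))] := tP _ (LS b).
Qed.

(** * Higman's lemma *)

Inductive embeds {A : Type} (R : A -> A -> Prop) : seq A -> seq A -> Prop :=
| embeds_nil t : embeds R [::] t
| embeds_skip s y t : embeds R s t -> embeds R s (y :: t)
| embeds_cons x s y t : R x y -> embeds R s t -> embeds R (x :: s) (y :: t).

Definition bad {T : Type} (R : T -> T -> Prop) (f : nat -> T) : Prop :=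
  forall a b, (a < b)%N -> ~ R (f a) (f b).

(** Nash-Williams' minimal bad sequence.  Stage [n] replaces the current bad
    sequence by one with the same first [n] terms and an [n]-th term of least
    possible size; the diagonal is bad because any finitely many of its terms
    lie together in one of the stages. *)
Lemma minimal_bad {T : Type} (R : T -> T -> Prop) (sz : T -> nat) :
  ~ wqo R ->
  exists2 f, bad R f &
    forall n h, bad R h -> (forall a, (a < n)%N -> h a = f a) ->
      (sz (f n) <= sz (h n))%N.
Proof.
move=> nwR.
have [f0 bad0] : exists f, bad R f.
  apply: boolp.contrapT => nobad; apply: nwR => f.
  apply: boolp.contrapT => nf; apply: nobad; exists f => a b ab Rab.
  by apply: nf; exists a, b.
pose better n (f f' : nat -> T) :=
  [/\ bad R f', forall a, (a < n)%N -> f' a = f a &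
      forall h, bad R h -> (forall a, (a < n)%N -> h a = f a) ->
        (sz (f' n) <= sz (h n))%N].
have step (nf : nat * (nat -> T)) : exists f', bad R nf.2 -> better nf.1 nf.2 f'.
  case: nf => n f /=; have [bf|nbf] := boolp.pselect (bad R f); last by exists f.
  apply: boolp.contrapT => no.
  (* Infinite descent on the size of the [n]-th term. *)
  have noh k h : (sz (h n) < k)%N -> bad R h ->
      ~ (forall a, (a < n)%N -> h a = f a).
    elim: k h => // k IHk h hk bh hf; apply: no; exists h => _; split=> // h' bh' h'f.
    rewrite leqNgt; apply/negP => lt; apply: (IHk h' _ bh' h'f).
    exact: leq_trans lt _.
  exact: (noh _ f (ltnSn _) bf).
have [next nextP] := boolp.choice step.
pose F := fix F n := if n is m.+1 then next (m, F m) else f0.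
have badF n : bad R (F n).
  by elim: n => //= n IHn; case: (nextP (n, F n) IHn).
have FP n : better n (F n) (F n.+1) by apply: (nextP (n, F n) (badF n)).
have Fst n m : (n < m)%N -> F m n = F n.+1 n.
  elim: m => // m IHm; rewrite ltnS leq_eqVlt => /orP[/eqP -> //|nm].
  by have [_ agree _] := FP m; rewrite (agree n nm) IHm.
exists (fun n => F n.+1 n).
  by move=> a b ab; rewrite -(@Fst a b.+1) ?ltnS ?(ltnW ab) //; apply: badF.
move=> n h bh hF; have [_ _] := FP n; apply=> // a an.
by rewrite hF // Fst.
Qed.

(** Split each (nonempty) word of a minimal bad sequence into head and tail,
    and take a subsequence [g] along which the heads increase.  Keeping the
    words before index [g 0] and continuing with the tails along [g] yields a
    bad sequence with a shorter word at index [g 0], against minimality. *)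
Lemma higman {A : Type} (R : A -> A -> Prop) :
  (forall x y z, R x y -> R y z -> R x z) -> wqo R -> wqo (embeds R).
Proof.
move=> Rtr wR; apply: boolp.contrapT => /(minimal_bad (@size A))[f bf fmin].
have /boolp.choice[ht htP] : forall n, exists ht : A * seq A, f n = ht.1 :: ht.2.
  move=> n; case fn: (f n) => [|x s]; last by exists (x, s).
  by case: (bf n n.+1 (ltnSn n)); rewrite fn; apply: embeds_nil.
have [g gh gR] := wqo_monotone Rtr wR (fun n => (ht n).1).
pose h k := if (k < g 0)%N then f k else (ht (g (k - g 0)%N)).2.
have g0 n : (g 0 <= g n)%N by case: n => // n; apply/ltnW/gh.
have bh : bad (embeds R) h.
  move=> a b ab; rewrite /h; case: (ltnP b (g 0)) => [bg|gb].
    by rewrite (ltn_trans ab bg); apply: bf.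
  case: (ltnP a (g 0)) => [ag|ga] emb.
    apply: (bf a (g (b - g 0)%N)); first exact: leq_trans ag (g0 _).
    by rewrite [f (g _)]htP; apply: embeds_skip.
  have lt : (a - g 0 < b - g 0)%N by rewrite ltn_sub2r // (leq_ltn_trans ga).
  apply: (bf _ _ (gh _ _ lt)); rewrite !htP; apply: embeds_cons => //.
  exact: gR.
have := fmin (g 0) h bh; rewrite {2}/h ltnn subnn htP /= ltnn => min.
by have /min : forall a, (a < g 0)%N -> h a = f a by move=> a; rewrite /h => ->.
Qed.

(** The position map of an embedding can be taken strictly increasing on all of
    [nat], which is the form that a shift of the variables requires. *)
Lemma embeds_nth {A : Type} (R : A -> A -> Prop) (x0 : A) s t :
  embeds R s t ->
  exists2 q : nat -> nat, {homo q : a b / (a < b)%N} &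
    forall k, (k < size s)%N -> R (nth x0 s k) (nth x0 t (q k)).
Proof.
elim=> {s t} [t|s y t _ [q qh qR]|x s y t Rxy _ [q qh qR]].
- by exists id.
- by exists (fun k => (q k).+1).
exists (fun k => if k is m.+1 then (q m).+1 else 0%N).
  by case=> [|a] [|b] //; rewrite !ltnS; apply: qh.
by case=> [|k] //; apply: qR.
Qed.

(** * Monomials up to shifting and divisibility *)

Section Monomials.
Context {c : nat}.
Implicit Types (u v : xmon c) (p : nat -> nat).

Lemma mon_dvdP u v : (forall x, u x <= v x)%N -> mon_dvd u v.
Proof.
move=> uv; exists (divcm v u); apply/eqP/cmP => x.
by rewrite cmM divcmE subnKC.
Qed.

Lemma inc_var_inj p : injective p -> injective (@inc_var c p).
Proof. by move=> pI [j k] [j' k'] [-> /pI ->]. Qed.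

Lemma inc_mon_var p u (x : xvar c) : injective p -> inc_mon p u (inc_var p x) = u x.
Proof.
move=> pI; rewrite (@inc_monE _ _ _ (x |` finsupp u)%fset) ?fsubsetUr //.
rewrite (big_fsetD1 x) ?fset1U1 //= eqxx mul1n big1_fset ?addn0 // => y.
rewrite !inE => /andP[/negP ynx _] _; case: eqP => // /(inc_var_inj pI).
by move/eqP/ynx.
Qed.

Lemma inc_mon_codom p u (y : xvar c) :
  (inc_mon p u y != 0)%N -> exists x, y = inc_var p x.
Proof.
move=> nz; apply: boolp.contrapT => ny; case/negP: nz; apply/eqP.
rewrite (inc_monE _ _ (fsubset_refl _)) big1 // => x _.
by case: eqP => // xy; case: ny; exists x.
Qed.

Lemma inc_mon_inj p : injective p -> injective (@inc_mon c p).
Proof.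
move=> pI u v uv; apply/eqP/cmP => x.
by rewrite -(inc_mon_var u x pI) uv inc_mon_var.
Qed.

(** Outside the image of [p] the shifted exponents vanish, so divisibility is
    an inequality at each variable of [u]. *)
Lemma inc_mon_dvd p u v : injective p ->
  (forall x, u x <= v (inc_var p x))%N -> mon_dvd (inc_mon p u) v.
Proof.
move=> pI uv; apply: mon_dvdP => y.
have [-> //|/[dup] /inc_mon_codom[x ->] _] := eqVneq (inc_mon p u y) 0%N.
by rewrite inc_mon_var.
Qed.

Lemma ltn_homo_inj p : {homo p : j k / (j < k)%N} -> injective p.
Proof.
by move=> ph a b pab; case: (ltngtP a b) => // /ph; rewrite pab ltnn.
Qed.

Definition width u : nat := \max_(x <- finsupp u) x.2.+1.

Lemma width_dflt u (x : xvar c) : (width u <= x.2)%N -> u x = 0%N.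
Proof.
move=> le; apply: fsfun_dflt; apply/negP => xu; move: le; rewrite leqNgt.
by rewrite /width (big_fsetD1 x) //= leq_max leqnn.
Qed.

Definition column u (k : nat) : 'I_c -> nat := fun j => u (j, k).

(** Relativized to an enumeration to be an instance of the relation of
    [wqo_pointwise]. *)
Definition col_le (a b : 'I_c -> nat) : Prop :=
  forall j, j \in enum 'I_c -> (a j <= b j)%N.

(** The word may end in zero columns: [width u] serves as its length for every
    [i], in place of the truncated difference [width u - i]. *)
Definition tail_word (i : nat) u : seq ('I_c -> nat) :=
  mkseq (fun k => column u (i + k)) (width u).

Definition inc_dvd (i : nat) u v : Prop :=
  exists2 p, inc_map i p & mon_dvd (inc_mon p u) v.

Lemma col_le_trans a b d : col_le a b -> col_le b d -> col_le a d.
Proof. by move=> ab bd j jc; apply: leq_trans (ab j jc) (bd j jc). Qed.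

(** The shift is the identity below [i] and the position map [q] of the
    embedding, moved up by [i], from there on. *)
Lemma inc_dvdP i u v :
  (forall x : xvar c, (x.2 < i)%N -> (u x <= v x)%N) ->
  embeds col_le (tail_word i u) (tail_word i v) -> inc_dvd i u v.
Proof.
move=> hd /(embeds_nth (fun _ => 0%N))[q qh qR].
pose p k := if (k < i)%N then k else (i + q (k - i))%N.
have ph : {homo p : a b / (a < b)%N}.
  move=> a b ab; rewrite /p; case: (ltnP b i) => [bi|ib].
    by rewrite (ltn_trans ab bi).
  case: (ltnP a i) => [ai|ia]; first by apply: leq_trans ai (leq_addr _ _).
  by rewrite ltn_add2l qh // ltn_sub2r // (leq_ltn_trans ia).
exists p; first by split=> // j ji; rewrite /p ji.
apply: inc_mon_dvd => [|[j k]]; first exact: ltn_homo_inj.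
rewrite /inc_var /p /=; case: ltnP => [ki|ik]; first exact: hd.
case: (ltnP (k - i) (width u)) => [ku|uk]; last first.
  by rewrite width_dflt //=; apply: leq_trans uk (leq_subr _ _).
have := qR (k - i)%N; rewrite size_mkseq => /(_ ku j); rewrite mem_enum => /(_ isT).
rewrite nth_mkseq // /column subnKC // => /leq_trans; apply.
(* If [q] leads past the end of the word of [v], the default letter is the
   zero column, so the bound on [u] already gives the claim. *)
case: (ltnP (q (k - i)%N) (width v)) => [qv|vq]; first by rewrite nth_mkseq.
by rewrite nth_default ?size_mkseq.
Qed.

(** Dickson's lemma on the columns before [i] and Higman's lemma on the rest. *)
Lemma wqo_inc_dvd i : wqo (inc_dvd i).
Proof.
pose X := [seq (j, k) | j <- enum 'I_c, k <- iota 0 i].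
pose hd u v := forall x : xvar c, x \in X -> (u x <= v x)%N.
have hd_tr u v w : hd u v -> hd v w -> hd u w.
  by move=> uv vw x xX; apply: leq_trans (uv x xX) (vw x xX).
have wqo_hd : wqo hd.
  exact: (wqo_preim (fun u : xmon c => u : xvar c -> nat) (@wqo_pointwise _ X)).
have wqo_tl : wqo (fun u v => embeds col_le (tail_word i u) (tail_word i v)).
  exact: (wqo_preim (tail_word i) (higman col_le_trans (@wqo_pointwise _ _))).
apply: wqo_sub (wqo_and hd_tr wqo_hd wqo_tl) => u v [uv emb].
apply: inc_dvdP => // -[j k] /= ki; apply: uv.
by apply/allpairsP; exists (j, k); rewrite mem_enum mem_iota.
Qed.

End Monomials.

(** * Initial monomials *)

Lemma total_max {T : eqType} (le : T -> T -> Prop) (s : seq T) :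
  (forall u v w, le u v -> le v w -> le u w) -> (forall u v, le u v \/ le v u) ->
  s <> [::] -> exists2 u, u \in s & forall v, v \in s -> le v u.
Proof.
move=> tr tot; elim: s => // x s IHs _.
have refl u : le u u by case: (tot u u).
have [->|/eqP/IHs[u us uP]] := eqVneq s [::].
  by exists x; rewrite ?mem_head // => v; rewrite inE => /eqP ->.
case: (tot x u) => [xu|ux].
  by exists u => [|v]; rewrite inE ?us ?orbT // => /orP[/eqP ->|/uP].
exists x => [|v]; rewrite ?mem_head // inE => /orP[/eqP -> //|/uP vu].
exact: tr vu ux.
Qed.

Section Initial.
Context {K : fieldType} {c : nat} (le : xmon c -> xmon c -> Prop).
Implicit Types (f g : xpoly K c).

Lemma initial_mon_exists f :
  monomial_order le -> f <> 0 -> exists u, initial_mon le f u.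
Proof.
move=> [[_ _ tr tot] _] /eqP; rewrite -msupp_eq0 => nz.
have [|u uf uP] := @total_max _ le (msupp f) tr tot.
  by move=> f0; case/fset0Pn: nz => x; rewrite -[x \in msupp f]/(x \in (msupp f : seq _)) f0.
by exists u.
Qed.

Lemma msupp_inc_act p f u :
  u \in msupp (inc_act p f) -> exists2 w, w \in msupp f & u = inc_mon p w.
Proof.
rewrite -mcoeff_neq0 raddf_sum /= => nz; apply: boolp.contrapT => no.
case/negP: nz; apply/eqP; rewrite big_seq big1 // => w wf.
by rewrite mcoeffU; case: eqP => // wu; case: no; exists w.
Qed.

(** Injectivity of [p] rules out cancellation between shifted terms. *)
Lemma mcoeff_inc_act p f u :
  injective p -> (inc_act p f)@_(inc_mon p u) = f@_u.
Proof.
move=> pI; rewrite raddf_sum /=.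
have E w : << f@_w *g inc_mon p w >>@_(inc_mon p u) = f@_w *+ (w == u) :> K.
  by rewrite mcoeffU (inj_eq (inc_mon_inj pI)).
under eq_bigr do rewrite E.
have [uf|uf] := boolP (u \in msupp f).
  rewrite (big_fsetD1 u) //= eqxx mulr1n big1_fset ?addr0 // => w.
  by rewrite !inE => /andP[/negPf -> _].
rewrite mcoeff_outdom // big_seq big1 // => w wf.
by case: eqP => // wu; rewrite -wu wf in uf.
Qed.

Lemma initial_mon_inc_act i p f u :
  inc_compatible i le -> inc_map i p ->
  initial_mon le f u -> initial_mon le (inc_act p f) (inc_mon p u).
Proof.
move=> comp pi [uf umax]; have pI := ltn_homo_inj (proj1 pi).
split; first by rewrite -mcoeff_neq0 mcoeff_inc_act // mcoeff_neq0.
by move=> v /msupp_inc_act[w wf ->]; apply: comp => //; apply: umax.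
Qed.

End Initial.

Theorem theorem3p5 (K : fieldType) (c : nat) (hc : (1 <= c)%N) (i : nat)
    (le : xmon c -> xmon c -> Prop)
    (hle : monomial_order le) (hcompat : inc_compatible i le)
    (I : xpoly K c -> Prop)
    (hI : is_ideal I) (hinv : inc_invariant i I) :
  exists B : {fset xpoly K c},
    inc_groebner_basis i le I (fun g => g \in B).
Proof.
have /boolp.choice[lead leadP] : forall f : xpoly K c, exists u,
    f <> 0 -> initial_mon le f u.
  move=> f; have [->|/eqP nz] := eqVneq f 0; first by exists mone.
  by have [u uP] := initial_mon_exists hle nz; exists u.
have [s sI sP] := wqo_finite_basis (fun f => I f /\ f <> 0)
  (wqo_preim lead (wqo_inc_dvd i)).
exists [fset g in s]%fset; split=> [g|f If nf].
  by rewrite inE => /sI[].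
have [g gs [p pi dvd]] := sP f (conj If nf).
have [_ ng] := sI g gs.
exists g, p, (inc_mon p (lead g)), (lead f); split; split=> //.
- by rewrite inE.
- by apply: (initial_mon_inc_act hcompat pi); apply: leadP.
- exact: leadP.
Qed.
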